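(* Let $n \ge 5$ be an integer, let $\mathcal{A}_n$ be the set of $2$-faces of the $n$-cube (so $|\mathcal{A}_n| = \binom{n}{2}2^{n-2}$), and let $\mathfrak{G}_n$ be the set of $n$-gaussoids. Then $$2^{\frac{1}{3} n 2^{n-6}} \;\le\; |\mathfrak{G}_n| \;\le\; \frac{2^{|\mathcal{A}_n|}}{2^{\frac{4}{9} n(n-1) 2^{n-6}}}.$$
   Context: Notation: $[n]=\{1,\dots,n\}$; unions of subsets and elements of $[n]$ are written by concatenation, e.g. $ijL=\{i\}\cup\{j\}\cup L$. $\mathcal{A}_n$ is the set of symbols $(ij|K)$ with $i\ne j$ in $[n]$ and $K\subseteq [n]\setminus\{i,j\}$, where $(ij|K)=(ji|K)$; these symbols index the $2$-faces (squares) of the $n$-cube $\{0,1\}^n$: $(ij|K)$ is the square extending in directions $i,j$, with coordinate $1$ at the positions in $K$ and $0$ at the remaining positions. An $n$-gaussoid ($n\ge 3$) is a subset $\mathcal{G}\subseteq\mathcal{A}_n$ such that for all pairwise distinct $i,j,k\in[n]$ and all $L\subseteq[n]\setminus\{i,j,k\}$ (writing a symbol for ''the symbol belongs to $\mathcal{G}$''): (G1) $(ij|L)\wedge(ik|jL)\Rightarrow(ik|L)\wedge(ij|kL)$; (G2) $(ij|kL)\wedge(ik|jL)\Rightarrow(ij|L)\wedge(ik|L)$; (G3) $(ij|L)\wedge(ik|L)\Rightarrow(ij|kL)\wedge(ik|jL)$; (G4) $(ij|L)\wedge(ij|kL)\Rightarrow(ik|L)\vee(jk|L)$. *)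

(* Defs.v *)
From mathcomp Require Import all_boot.

Set Implicit Arguments.
Unset Strict Implicit.
Unset Printing Implicit Defensive.

(** The symbol (ij|K) is encoded as the pair ([set i; j], K), so that
    (ij|K) = (ji|K); [n] is 'I_n, numbered from 0.  It stands for the 2-face
    of the n-cube consisting of the four 0/1-vectors that are 1 on K and 0
    outside of K and {i, j}. *)
Notation symbol n := ({set 'I_n} * {set 'I_n})%type.

Definition sq (n : nat) (i j : 'I_n) (K : {set 'I_n}) : symbol n :=
  ([set i; j], K).

Definition squares (n : nat) : {set symbol n} :=
  [set s : symbol n | (#|s.1| == 2) && [disjoint s.1 & s.2]].

Definition G1 (n : nat) (G : {set symbol n}) i j k L : bool :=
  (sq i j L \in G) && (sq i k (j |: L) \in G) ==>
  (sq i k L \in G) && (sq i j (k |: L) \in G).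

Definition G2 (n : nat) (G : {set symbol n}) i j k L : bool :=
  (sq i j (k |: L) \in G) && (sq i k (j |: L) \in G) ==>
  (sq i j L \in G) && (sq i k L \in G).

Definition G3 (n : nat) (G : {set symbol n}) i j k L : bool :=
  (sq i j L \in G) && (sq i k L \in G) ==>
  (sq i j (k |: L) \in G) && (sq i k (j |: L) \in G).

Definition G4 (n : nat) (G : {set symbol n}) i j k L : bool :=
  (sq i j L \in G) && (sq i j (k |: L) \in G) ==>
  (sq i k L \in G) || (sq j k L \in G).

Definition is_gaussoid (n : nat) (G : {set symbol n}) : bool :=
  (G \subset squares n) &&
  [forall i : 'I_n, forall j : 'I_n, forall k : 'I_n, forall L : {set 'I_n},
     [&& i != j, i != k, j != k, i \notin L, j \notin L & k \notin L] ==>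
     [&& G1 G i j k L, G2 G i j k L, G3 G i j k L & G4 G i j k L]].

Definition gaussoids (n : nat) : {set {set symbol n}} :=
  [set G | is_gaussoid G].

Lemma squaresP (n : nat) (s : symbol n) :
  reflect (exists (i j : 'I_n) (K : {set 'I_n}),
             [/\ i != j, i \notin K, j \notin K & s = sq i j K])
          (s \in squares n).
Proof.
rewrite inE; apply: (iffP andP).
  case: s => e K /= [/cards2P [i [j [ij ->]]]].
  rewrite disjoints_subset => /subsetP sK; exists i, j, K; split=> //.
    by have := sK i; rewrite !inE eqxx => /(_ isT).
  by have := sK j; rewrite !inE eqxx orbT => /(_ isT).
move=> [i [j [K [ij iK jK ->]]]] /=; split; first by rewrite cards2 ij.
by rewrite disjoints_subset; apply/subsetP => x; rewrite !inE => /orP [] /eqP->.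
Qed.

Lemma card_squares (n : nat) : #|squares n| = 'C(n, 2) * 2 ^ (n - 2).
Proof.
have -> : #|squares n| =
    \sum_(e : {set 'I_n} | #|e| == 2) \sum_(K : {set 'I_n} | [disjoint e & K]) 1.
  by rewrite pair_big_dep sum1_card; apply: eq_card => s; rewrite !inE.
rewrite (eq_bigr (fun=> 2 ^ (n - 2))) => [|e /eqP e2].
  by rewrite sum_nat_const -[n in 'C(n, 2)](card_ord n) -card_draws cardsE.
have <- : #|~: e| = n - 2 by rewrite -e2 cardsCs setCK card_ord.
rewrite sum1_card -card_powerset.
by apply: eq_card => K; rewrite powersetE -disjoints_subset disjoint_sym.
Qed.

(* Main.v *)
Require Import Defs.
From mathcomp Require Import all_boot all_order all_algebra.
From mathcomp Require Import reals exp.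
From mathcomp Require Import zify ring lra.

(** Both bounds localize to the 3-dimensional faces of the n-cube: each gaussoid
    axiom speaks only of the six squares of one 3-cube.

    Lower bound.  A single square satisfies the axioms in every 3-cube that
    contains it.  Hence, if no two squares of a set S lie in a common 3-cube,
    all 2^|S| subsets of S are gaussoids ([sparse_gaussoid]).  Two squares
    (e|K), (e'|K') of a common 3-cube have either |e :&: e'| = 1, or e = e' and
    K, K' of sizes that differ by one.  So S may consist of the (e|K) with e in
    a fixed matching and |K| of a fixed parity.

    Upper bound.  Only 11 of the 64 sets of squares of a 3-cube are
    3-gaussoids, and 11 < 64 / 4.  In a packing of m 3-cubes, no two with a
    common square, these restrictions are independent, so that there are at
    most 2^|A_n| / 4^m gaussoids ([trace_product_bound]).  All 3-cubes with
    direction set in F, a partial Steiner triple system, form such a packing: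
    two distinct triples of F share no pair, and two distinct parallel 3-cubes
    share no square.

    Matching and triple system are instances of one construction: among the
    m-subsets of Z/n with a given sum of elements, no two distinct ones share
    m - 1 elements, and some sum is attained at least C(n, m) / n times
    ([same_sum_family]).  The resulting exponents, about n 2^n / 16 and
    n^2 2^n / 24, leave ample room for those of the theorem. *)

Set Implicit Arguments.
Unset Strict Implicit.
Unset Printing Implicit Defensive.

Import Order.TTheory GRing.Theory Num.Theory.
Local Open Scope ring_scope.

(** * Counting in finite sets *)

Lemma large_fibre (T C : finType) (A : {set T}) (f : T -> C) (c0 : C) :
  exists c, (#|A| <= #|C| * #|[set x in A | f x == c]|)%N.
Proof.
have [c _ cmax] := arg_maxnP (fun c => #|[set x in A | f x == c]|) (isT : predT c0).
exists c; rewrite -sum1_card (partition_big f predT) //= -sum_nat_const.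
apply: leq_sum => d _; apply: leq_trans (cmax d isT).
by rewrite -sum1_card leq_eqVlt; apply/orP/or_introl/eqP/eq_bigl=> x; rewrite inE.
Qed.

(** Elements of a set of given sum are determined by the others: this is the
    Graham-Sloane construction of constant weight codes. *)
Lemma same_sum_family (n m : nat) : (0 < n)%N ->
  exists F : {set {set 'I_n}},
    [/\ ('C(n, m) <= n * #|F|)%N,
        forall A, A \in F -> #|A| = m
      & forall A B x y, A \in F -> B \in F -> x \in A -> y \in B ->
          A :\ x = B :\ y -> x = y].
Proof.
case: n => // n _; pose D := [set A : {set 'I_n.+1} | #|A| == m].
have [c cD] := large_fibre D (fun A : {set 'I_n.+1} => \sum_(i in A) i) ord0.
exists [set A in D | \sum_(i in A) i == c]; split.
- by move: cD; rewrite card_draws !card_ord.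
- by move=> A; rewrite !inE => /andP [/eqP].
move=> A B x y; rewrite !inE => /andP [_ /eqP Ac] /andP [_ /eqP Bc] xA yB AB.
have : \sum_(i in A) i = \sum_(i in B) i by rewrite Ac Bc.
by rewrite (big_setD1 x) //= (big_setD1 y yB) /= AB => /addIr.
Qed.

(** A face of the n-cube is a set of directions together with the set of
    coordinates fixed to 1, as for the symbols in dimension two. *)
Lemma card_faces (n m : nat) (F : {set {set 'I_n}}) :
  (forall A, A \in F -> #|A| = m) ->
  #|[set c : symbol n | (c.1 \in F) && [disjoint c.1 & c.2]]| =
    (#|F| * 2 ^ (n - m))%N.
Proof.
move=> Fm.
have -> : #|[set c : symbol n | (c.1 \in F) && [disjoint c.1 & c.2]]| =
    (\sum_(A in F) \sum_(K : {set 'I_n} | [disjoint A & K]) 1)%N.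
  by rewrite pair_big_dep sum1_card; apply: eq_card => s; rewrite !inE.
rewrite (eq_bigr (fun=> 2 ^ (n - m))%N) ?sum_nat_const // => A /Fm Am.
have <- : #|~: A| = (n - m)%N by rewrite -Am cardsCs setCK card_ord.
rewrite sum1_card -card_powerset.
by apply: eq_card => K; rewrite powersetE -disjoints_subset disjoint_sym.
Qed.

(** If the traces of E on each of several disjoint blocks make up at most the
    proportion 1/d of all subsets of the block, these savings multiply: a member
    of E is determined by its trace on one block and the part outside that
    block, and removing the block leaves the other traces unchanged. *)
Lemma trace_product_bound (T I : finType) (d : nat) (X : {set T})
    (E : {set {set T}}) (J : {set I}) (B : I -> {set T}) :
  (forall A, A \in E -> A \subset X) ->
  (forall i, i \in J -> B i \subset X) ->
  (forall i j, i \in J -> j \in J -> i != j -> [disjoint B i & B j]) ->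
  (forall i, i \in J -> #|[set A :&: B i | A in E]| * d <= 2 ^ #|B i|)%N ->
  (#|E| * d ^ #|J| <= 2 ^ #|X|)%N.
Proof.
move: {2}#|J| (erefl #|J|) => k; elim: k J X E => [|k IHk] J X E Jk EX BX disB trB.
  rewrite Jk muln1 -card_powerset; apply/subset_leq_card/subsetP => A /EX.
  by rewrite powersetE.
have /card_gt0P [i iJ] : (0 < #|J|)%N by rewrite Jk.
have J'k : #|J :\ i| = k by move: Jk; rewrite (cardsD1 i) iJ => -[].
(* The rest of the family lives on the complement of the block B i. *)
pose E' := [set A :\: B i | A in E].
have bnd' : (#|E'| * d ^ k <= 2 ^ #|X :\: B i|)%N.
  rewrite -J'k; apply: IHk => //.
  - by move=> _ /imsetP [A AE ->]; apply: setSD; apply: EX.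
  - move=> j /setD1P [ji jJ]; rewrite subsetD BX //=.
    exact: disB.
  - by move=> j l /setD1P [_ jJ] /setD1P [_ lJ]; apply: disB.
  move=> j /setD1P [ji jJ]; apply: leq_trans (trB j jJ).
  rewrite leq_mul2r -imset_comp; apply/orP/or_intror/subset_leq_card.
  apply/subsetP => _ /imsetP [A AE ->]; apply/imsetP; exists A => //=.
  apply/setP => x; rewrite !inE; case: (boolP (x \in B j)); rewrite ?andbF //.
  by move=> xj; rewrite (disjointFr (disB _ _ jJ iJ ji) xj).
have prodE : (#|E| <= #|[set A :&: B i | A in E]| * #|E'|)%N.
  rewrite -cardsX -(card_imset _ (f := fun A => (A :&: B i, A :\: B i))).
    apply/subset_leq_card/subsetP => _ /imsetP [A AE ->].
    by rewrite inE /=; apply/andP; split; apply/imsetP; exists A.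
  by move=> A A' [AI AD]; rewrite -(setID A (B i)) AI AD setID.
have -> : #|X| = (#|B i| + #|X :\: B i|)%N.
  by rewrite -(cardsID (B i) X) (setIidPr (BX i iJ)).
rewrite Jk expnS expnD; apply: leq_trans (leq_mul (trB i iJ) bnd').
by rewrite mulnACA leq_mul2r prodE orbT.
Qed.

(** * Squares without common 3-cubes *)

(** The first three axioms have two squares with exactly one common direction
    as premises, excluded by the choice of F; the fourth has two squares with
    the same directions, excluded by the parity. *)
Lemma sparse_gaussoid (n : nat) (F : {set {set 'I_n}}) (b : bool)
    (G : {set symbol n}) :
  (forall A, A \in F -> #|A| = 2%N) ->
  (forall A B x y, A \in F -> B \in F -> x \in A -> y \in B ->
     A :\ x = B :\ y -> x = y) ->
  G \subset [set s in [set c : symbol n | (c.1 \in F) && [disjoint c.1 & c.2]]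
            | odd #|s.2| == b] ->
  G \in gaussoids n.
Proof.
move=> F2 Fsep /subsetP GF; rewrite inE; apply/andP; split.
  apply/subsetP => s /GF; rewrite !inE => /andP [/andP [/F2 -> ->] _] //.
apply/'forall_'forall_'forall_forallP => i j k L; apply/implyP.
case/and5P=> ij ik jk iL /andP [jL kL].
have inF x y K : sq x y K \in G -> [set x; y] \in F.
  by move/GF; rewrite !inE => /andP [/andP []].
have D1 x y : x != y -> [set x; y] :\ y = [set x].
  by move=> xy; rewrite setUC setU1K // inE eq_sym.
have disj K K' : sq i j K \in G -> sq i k K' \in G -> False.
  move=> /inF jF /inF kF; move/eqP: jk; apply.
  by apply: Fsep jF kF _ _ _; rewrite ?set22 // !D1.
apply/and4P; split; apply/implyP => /andP [h1 h2].
- by case: (disj _ _ h1 h2).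
- by case: (disj _ _ h1 h2).
- by case: (disj _ _ h1 h2).
move/GF: h1; move/GF: h2; rewrite !inE /= => /andP [_ /eqP <-] /andP [_].
by rewrite cardsU1 kL /=; case: odd.
Qed.

(** The factor 4 collects two losses of one half: the matching has at least
    (n - 1) / 2 edges, and one of two parities is kept. *)
Lemma many_gaussoids (n : nat) : (0 < n)%N ->
  exists2 k, ((n - 1) * 2 ^ (n - 2) <= 4 * k)%N & (2 ^ k <= #|gaussoids n|)%N.
Proof.
move=> n0; have [F [Fbig F2 Fsep]] := same_sum_family 2 n0.
pose S := [set c : symbol n | (c.1 \in F) && [disjoint c.1 & c.2]].
have [b Sb] := large_fibre S (fun s : symbol n => odd #|s.2|) true.
rewrite card_bool (card_faces F2) in Sb.
exists #|[set s in S | odd #|s.2| == b]|; last first.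
  rewrite -card_powerset; apply/subset_leq_card/subsetP => G.
  by rewrite powersetE; apply: sparse_gaussoid.
have : (n * (n - 1) <= n * (2 * #|F|))%N.
  rewrite mulnCA; apply: leq_trans (leq_mul (leqnn 2) Fbig).
  by rewrite mul_bin_left bin1 mulnC.
rewrite leq_pmul2l // => F_ge.
apply: (@leq_trans (2 * #|F| * 2 ^ (n - 2))%N); first by rewrite leq_mul2r F_ge orbT.
by rewrite -mulnA -[4%N]/(2 * 2)%N -[leqRHS]mulnA leq_mul2l Sb orbT.
Qed.

(** * Packing 3-cubes *)

(** The pair (x, b) names the square of the 3-cube c that is orthogonal to
    direction x, at coordinate b. *)
Definition cube_squares (n : nat) (c : symbol n) : {set symbol n} :=
  [set (c.1 :\ p.1, if p.2 then p.1 |: c.2 else c.2) | p in setX c.1 [set: bool]].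

Lemma card_cube_squares (n : nat) (c : symbol n) :
  [disjoint c.1 & c.2] -> #|cube_squares c| = (#|c.1| * 2)%N.
Proof.
case: c => T L /= TL; rewrite card_in_imset ?cardsX ?cardsT ?card_bool //.
move=> [x a] [y b]; rewrite !inE !andbT /= => xT yT [TD LL].
have xy : x = y.
  apply/eqP; move/setP/(_ x): TD; rewrite !inE eqxx xT andbT /=.
  by case: eqP.
move: LL; rewrite xy; move: (disjointFr TL yT) => yL.
by case: a; case: b => // /setP /(_ y); rewrite !inE eqxx yL.
Qed.

Lemma cube_squares_sub (n : nat) (c : symbol n) :
  #|c.1| = 3%N -> [disjoint c.1 & c.2] -> cube_squares c \subset squares n.
Proof.
case: c => T L /= T3 TL; apply/subsetP => _ /imsetP [[x b] /setXP [/= xT _] ->].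
rewrite inE /=; apply/andP; split.
  by move: T3; rewrite (cardsD1 x) xT add1n => -[->].
have dL : [disjoint T :\ x & L] by apply: disjointWl TL; apply: subD1set.
case: b => //; rewrite disjoint_sym disjoints_subset; apply/subsetP => y.
rewrite !inE; case: eqP => //= _ yL; by rewrite (disjointFl TL yL).
Qed.

(** A square together with the missing direction determines its 3-cube, so a
    common square forces equality as soon as it forces a common missing
    direction. *)
Lemma cube_squares_disjoint (n : nat) (c d : symbol n) :
  (forall x y, x \in c.1 -> y \in d.1 -> c.1 :\ x = d.1 :\ y -> x = y) ->
  [disjoint c.1 & c.2] -> [disjoint d.1 & d.2] ->
  c != d -> [disjoint cube_squares c & cube_squares d].
Proof.
case: c d => T L [U M] /= sep TL UM; apply: contraNT => /pred0Pn [s /=].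
case/andP=> /imsetP [[x a] /setXP [/= xT _] ->].
case/imsetP=> -[y b] /setXP [/= yU _] [TU LM].
have xy := sep x y xT yU TU; rewrite -{y}xy in yU TU LM *.
rewrite -(setD1K xT) TU setD1K // xpair_eqE eqxx /=; apply/eqP.
have DL (K : {set 'I_n}) : x \notin K -> forall e : bool, (if e then x |: K else K) :\ x = K.
  by move=> xK [|]; [rewrite setU1K | apply/setDidPl; rewrite disjoint_sym disjoints1].
rewrite -(DL L _ a) ?(disjointFr TL) // LM DL //.
by rewrite (disjointFr UM yU).
Qed.



Definition bitseqs (k : nat) : seq bitseq :=
  iter k (fun ms => [seq b :: m | b <- [:: true; false], m <- ms]) [:: [::]].

Lemma mem_bitseqs (m : bitseq) : m \in bitseqs (size m).
Proof.
elim: m => // b m IHm; apply/allpairsP; exists (b, m) => /=.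
by split=> //; case: b.
Qed.

(** The axioms for all orders of the three directions, as conditions on the six
    membership bits; the bit ijk stands for the square (ij|kL), and so on. *)
Definition gaussoid3 (m : bitseq) : bool :=
  if m is [:: ij; ijk; ik; ikj; jk; jki] then
    [&& ij && ikj ==> ik && ijk, ik && ijk ==> ij && ikj,
        ij && jki ==> jk && ijk, jk && ijk ==> ij && jki,
        ik && jki ==> jk && ikj & jk && ikj ==> ik && jki] &&
    [&& ijk && ikj ==> ij && ik, ijk && jki ==> ij && jk
      & ikj && jki ==> ik && jk] &&
    [&& ij && ik ==> ijk && ikj, ij && jk ==> ijk && jki
      & ik && jk ==> ikj && jki] &&
    [&& ij && ijk ==> ik || jk, ik && ikj ==> ij || jk
      & jk && jki ==> ij || ik]
  else false.

Lemma count_gaussoid3 : count gaussoid3 (bitseqs 6) = 11%N.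
Proof. by []. Qed.

Lemma gaussoid_restrict (n : nat) (G : {set symbol n}) (i j k : 'I_n)
    (L : {set 'I_n}) :
  G \in gaussoids n ->
  i != j -> i != k -> j != k -> i \notin L -> j \notin L -> k \notin L ->
  gaussoid3 [seq s \in G | s <- [:: sq i j L; sq i j (k |: L); sq i k L;
    sq i k (j |: L); sq j k L; sq j k (i |: L)]].
Proof.
rewrite inE => /andP [_ /'forall_'forall_'forall_forallP axG].
have sqC (x y : 'I_n) K : sq x y K = sq y x K by rewrite /sq setUC.
have ax x y z : x != y -> x != z -> y != z -> x \notin L -> y \notin L ->
    z \notin L -> [&& G1 G x y z L, G2 G x y z L, G3 G x y z L & G4 G x y z L].
  move=> xy xz yz xL yL zL; apply: (implyP (axG x y z L)).
  by rewrite xy xz yz xL yL zL.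
move=> ij ik jk iL jL kL; have [ji ki kj] : [/\ j != i, k != i & k != j].
  by rewrite ![_ == i]eq_sym [k == j]eq_sym ij ik jk.
move: (ax i j k ij ik jk iL jL kL) (ax i k j ik ij kj iL kL jL).
move: (ax j i k ji jk ik jL iL kL) (ax j k i jk ji ki jL kL iL).
move: (ax k i j ki kj ij kL iL jL) (ax k j i kj ki ji kL jL iL).
(* All six squares now occur in one spelling each, so the rest is a
   propositional check on six booleans. *)
rewrite /G1 /G2 /G3 /G4 !(sqC j i) !(sqC k i) !(sqC k j) /=.
by do 6![case: (_ \in G)].
Qed.

Lemma cube_squaresE (n : nat) (i j k : 'I_n) (L : {set 'I_n}) :
  i != j -> i != k -> j != k ->
  cube_squares ([set i; j; k], L) =
    [set:: [:: sq i j L; sq i j (k |: L); sq i k L;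
               sq i k (j |: L); sq j k L; sq j k (i |: L)]].
Proof.
move=> ij ik jk; set T := [set i; j; k].
have Tk : T :\ k = [set i; j].
  by rewrite /T setUC setU1K // !inE negb_or eq_sym ik eq_sym jk.
have Tj : T :\ j = [set i; k].
  by rewrite /T setUAC setUC setU1K // !inE negb_or eq_sym ij jk.
have Ti : T :\ i = [set j; k].
  by rewrite /T -setUA setU1K // !inE negb_or ij ik.
have face x b : x \in T ->
    (T :\ x, if b then x |: L else L) \in cube_squares (T, L).
  by move=> xT; apply/imsetP; exists (x, b); rewrite // !inE /= in xT *; rewrite xT.
have [iT jT kT] : [/\ i \in T, j \in T & k \in T] by rewrite !inE !eqxx ?orbT.
apply/eqP; rewrite eqEsubset; apply/andP; split; apply/subsetP => s.
  case/imsetP => -[x b] /setXP [/= xT _] ->.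
  move: xT; rewrite !inE => /orP [/orP [] |] /eqP ->; rewrite /= ?Ti ?Tj ?Tk;
    by case: b; rewrite /sq eqxx ?orbT.
rewrite !inE /sq -Ti -Tj -Tk => /or4P [||| /or3P []] /eqP ->.
- exact: (face k false).
- exact: (face k true).
- exact: (face j false).
- exact: (face j true).
- exact: (face i false).
- exact: (face i true).
Qed.

(** A trace is the selection of some of the six squares by a bit sequence that
    passes the test [gaussoid3], and there are 11 of these. *)
Lemma card_traces (n : nat) (c : symbol n) :
  #|c.1| = 3%N -> [disjoint c.1 & c.2] ->
  (#|[set G :&: cube_squares c | G in gaussoids n]| <= 11)%N.
Proof.
case: c => T L /= T3 TL.
have [k kT] : exists k, k \in T by apply/card_gt0P; rewrite T3.
have /cards2P [i [j [ij Tk]]] : #|T :\ k| == 2.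
  by move: T3; rewrite (cardsD1 k T) kT add1n => -[->].
have [ik jk] : i != k /\ j != k.
  by split; [have := set21 i j | have := set22 i j]; rewrite -Tk => /setD1P [].
have {Tk kT T3} defT : T = [set i; j; k] by rewrite -(setD1K kT) Tk setUC.
rewrite {T}defT in TL *.
have nL x : x \in [set i; j; k] -> x \notin L by move/(disjointFr TL) ->.
rewrite cube_squaresE //; set six := [:: sq i j L; _; _; _; _; _].
rewrite -count_gaussoid3 -size_filter -(size_map (fun m => [set:: mask m six])).
apply: leq_trans (card_size _); apply/subset_leq_card/subsetP => _ /imsetP [G GG ->].
apply/mapP; exists [seq s \in G | s <- six].
  rewrite mem_filter (mem_bitseqs [seq s \in G | s <- six]) andbT.
  by apply: gaussoid_restrict => //; apply: nL; rewrite !inE eqxx ?orbT.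
by rewrite -filter_mask; apply/setP => s; rewrite in_setI !in_set mem_filter.
Qed.

(** The number m of packed 3-cubes is |F| 2^(n - 3) with
    |F| >= C(n, 3) / n = (n - 1) (n - 2) / 6; each saves two bits. *)
Lemma few_gaussoids (n : nat) : (0 < n)%N ->
  exists2 m, ((n - 1) * (n - 2) * 2 ^ (n - 3) <= 6 * m)%N
           & (#|gaussoids n| * 2 ^ (2 * m) <= 2 ^ #|squares n|)%N.
Proof.
move=> n0; have [F [Fbig F3 Fsep]] := same_sum_family 3 n0.
pose C := [set c : symbol n | (c.1 \in F) && [disjoint c.1 & c.2]].
have CP c : c \in C -> c.1 \in F /\ [disjoint c.1 & c.2].
  by rewrite inE => /andP.
exists #|C|; last first.
  rewrite expnM; apply: (trace_product_bound (B := @cube_squares n)).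
  - by move=> G; rewrite inE => /andP [].
  - by move=> c /CP [/F3 c3 cd]; apply: cube_squares_sub.
  - move=> c d /CP [cF cL] /CP [dF dL]; apply: cube_squares_disjoint => // x y.
    exact: Fsep.
  move=> c /CP [/F3 c3 cd]; rewrite card_cube_squares // c3.
  apply: (@leq_trans (11 * 4)) => //.
  by rewrite leq_mul2r card_traces.
rewrite (card_faces F3) mulnA leq_mul2r; apply/orP/or_intror.
rewrite -(leq_pmul2l n0) mulnA [leqRHS]mulnCA.
apply: leq_trans (leq_mul (leqnn 6) Fbig).
have -> : (6 * 'C(n, 3) = 2 * (3 * 'C(n, 3)))%N by rewrite mulnA.
rewrite mul_bin_left mulnCA mul_bin_left bin1.
by rewrite [leqRHS]mulnC [((n - 1) * n)%N]mulnC.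
Qed.

(** * The two bounds *)

Theorem theorem3p12 (R : realType) (n : nat) (hn : (5 <= n)%N) :
  (2 : R) `^ (1 / 3 * n%:R * 2 ^ (n%:Z - 6)) <= #|gaussoids n|%:R :> R
  /\
  #|gaussoids n|%:R <=
    2 ^+ #|squares n| / 2 `^ (4 / 9 * n%:R * (n%:R - 1) * 2 ^ (n%:Z - 6)) :> R.
Proof.
have n0 : (0 < n)%N by apply: leq_trans hn.
pose q : R := 2 ^+ (n - 3).
have q0 : 0 <= q by rewrite exprn_ge0.
(* With q = 2^(n - 3) both exponents become polynomials in n and q. *)
have zq : (2 : R) ^ (n%:Z - 6) = q / 8.
  have -> : n%:Z - 6 = (n - 3)%N%:Z - 3%:Z by lia.
  rewrite expfzDr ?pnatr_eq0 // -exprnP -exprnN /q; congr (_ / _); ring.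
have n5 : (5 : R) <= n%:R by rewrite ler_nat.
rewrite zq; split.
  have [k k_ge k_le] := many_gaussoids n0.
  apply: (@le_trans _ _ ((2 : R) ^+ k)); last by rewrite -natrX ler_nat.
  rewrite -powR_mulrn // ler_powR ?ler1n //.
  move: k_ge; rewrite (_ : n - 2 = (n - 3).+1)%N; last by lia.
  rewrite expnS -(ler_nat R) !natrM natrB // natrX -/q => k_ge.
  nra.
have [m m_ge m_le] := few_gaussoids n0.
rewrite ler_pdivlMr ?powR_gt0 //.
apply: (@le_trans _ _ (#|gaussoids n|%:R * 2 ^+ (2 * m))); last first.
  by rewrite -!natrX -natrM ler_nat.
apply: ler_wpM2l => //; rewrite -powR_mulrn // ler_powR ?ler1n //.
move: m_ge; rewrite -(ler_nat R) !natrM !natrB ?(leq_trans _ hn) // natrX -/q => m_ge.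
(* This is 6 (n - 2) >= n, multiplied by (n - 1) q. *)
have : 0 <= q * (n%:R - 1) * (5 * n%:R - 12) by rewrite !mulr_ge0 //; lra.
lra.
Qed.
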